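(* Let $\varphi\colon\mathbb{R}^n\to\overline{\mathbb{R}}$ be a lower semicontinuous function, and fix $\bar x\in\mathbb{R}^n$ such that $|\varphi(\bar x)|<\infty$. Then the following assertions hold. (a) Pick $u\in\mathbb{S}$. If $\bar x$ is a local minimizer of $\varphi$ in direction $u$, then $\mathrm{d}\varphi(\bar x)(u)\ge0$. (b) If $\bar x$ is a local minimizer of $\varphi$, then $\mathrm{d}\varphi(\bar x)(u)\ge0$ for all $u\in\mathbb{S}$.
   Context: $\overline{\mathbb{R}}:=\mathbb{R}\cup\{-\infty,\infty\}$; $\|\cdot\|$ is the Euclidean norm; $\mathbb{S}:=\{u\in\mathbb{R}^n : \|u\|=1\}$. Directional neighborhoods: for $\varepsilon,\rho>0$ and $u\in\mathbb{R}^n$, $\mathbb{B}_{\varepsilon,\rho}(u):=\{w\in\mathbb{R}^n : \|w\|\le\varepsilon,\ \big\|\|w\|u-\|u\|w\big\|\le\rho\|u\|\|w\|\}$. Directional local minimality: $\bar x$ (with $|\varphi(\bar x)|<\infty$) is a local minimizer of $\varphi$ in direction $u$ if there are $\varepsilon,\rho>0$ with $\varphi(x)\ge\varphi(\bar x)$ for all $x\in\bar x+\mathbb{B}_{\varepsilon,\rho}(u)$. A local minimizer is meant in the usual sense (equivalently, $u=0$). First subderivative: $\mathrm{d}\varphi(\bar x)(u):=\liminf_{t\downarrow0,\,u'\to u}\frac{\varphi(\bar x+tu')-\varphi(\bar x)}{t}$. *)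

(* Defs.v *)
From HB Require Import structures.
From mathcomp Require Import all_boot all_order all_algebra.
From mathcomp Require Import all_classical all_reals all_analysis.

Set Implicit Arguments.
Unset Strict Implicit.
Unset Printing Implicit Defensive.

Import Order.TTheory GRing.Theory Num.Theory.
Import numFieldNormedType.Exports.

Local Open Scope classical_set_scope.
Local Open Scope ring_scope.

(* The library norm `|u| on row vectors is the sup norm, hence this definition;
   both norms induce the canonical (product) topology of 'rV[R]_n. *)
Definition enorm (R : realType) (n : nat) (u : 'rV[R]_n) : R :=
  Num.sqrt (\sum_(i < n) u ord0 i ^+ 2).

Definition unit_sphere (R : realType) (n : nat) : set 'rV[R]_n :=
  [set u | enorm u = 1].

Definition dir_nbhd (R : realType) (n : nat) (eps rho : R) (u : 'rV[R]_n) :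
    set 'rV[R]_n :=
  [set w | enorm w <= eps /\
           enorm (enorm w *: u - enorm u *: w) <= rho * enorm u * enorm w].

Definition dir_local_minimizer (R : realType) (n : nat)
    (phi : 'rV[R]_n -> \bar R) (xbar u : 'rV[R]_n) : Prop :=
  exists eps rho : R, [/\ 0 < eps, 0 < rho &
    forall w, dir_nbhd eps rho u w -> (phi xbar <= phi (xbar + w)%R)%E].

Definition local_minimizer (R : realType) (n : nat)
    (phi : 'rV[R]_n -> \bar R) (xbar : 'rV[R]_n) : Prop :=
  \forall x \near xbar, (phi xbar <= phi x)%E.

(* Meaningful when phi xbar is finite, so that the difference below is never of
   the form oo - oo. As usual for subderivatives, u' = u is allowed in the
   lower limit, whereas t is restricted to positive values. *)
Definition subderivative (R : realType) (n : nat)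
    (phi : 'rV[R]_n -> \bar R) (xbar u : 'rV[R]_n) : \bar R :=
  limf_einf (fun p : R * 'rV[R]_n =>
      (phi (xbar + p.1 *: p.2)%R - phi xbar) / p.1%:E)%E
    (filter_prod (0 : R)^'+ (nbhs u)).

(* Main.v *)
Require Import Defs.
From mathcomp Require Import all_boot all_order all_algebra.
From mathcomp Require Import all_classical all_reals all_analysis.

Import numFieldNormedType.Exports.
Import Order.TTheory GRing.Theory Num.Theory.

(** A lower limit is nonnegative as soon as the function is eventually
    nonnegative, so it suffices that [phi xbar <= phi (xbar + t *: v)] for all
    small [t > 0] and all [v] close to [u] (lemma [subderivative_ge0]).

    For an ordinary local minimizer this holds because [xbar + t *: v] tends to
    [xbar].  For a minimizer in the unit direction [u], it holds because
    [t *: v] eventually enters every directional neighborhood of [u] (lemma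
    [dir_nbhd_scale_near]): the cone inequality is positively homogeneous in
    its argument, hence a condition on [v] alone, and it is strict at [v = u];
    by continuity of the Euclidean norm it persists for [v] near [u], while the
    radius bound holds since [t * enorm v] tends to 0. *)

Local Open Scope classical_set_scope.
Local Open Scope ring_scope.

Lemma enormZ (R : realType) (n : nat) (a : R) (u : 'rV[R]_n) :
  enorm (a *: u) = `|a| * enorm u.
Proof.
rewrite /enorm; under eq_bigr do rewrite mxE exprMn.
by rewrite -mulr_sumr sqrtrM ?sqr_ge0// sqrtr_sqr.
Qed.

Lemma enorm0 (R : realType) (n : nat) : enorm (0 : 'rV[R]_n) = 0.
Proof. by rewrite -(scale0r 0) enormZ normr0 mul0r. Qed.

Lemma enorm_continuous (R : realType) (n : nat) :
  continuous (@enorm R n).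
Proof.
move=> u; rewrite /enorm.
apply: (@continuous_comp _ _ _ (fun v : 'rV[R]_n => \sum_(i < n) v ord0 i ^+ 2)
  Num.sqrt); last exact: sqrt_continuous.
move: u; apply: (continuous_big (op := +%R)) => [|i _ v].
  exact: add_continuous.
apply: (continuous_comp (g := fun x : R => x ^+ 2)); last exact: exprn_continuous.
exact: coord_continuous.
Qed.

Lemma near_fst_gt0 (R : realType) (n : nat) (u : 'rV[R]_n) :
  \forall p \near filter_prod (0 : R)^'+ (nbhs u), 0 < p.1.
Proof.
exact: (@cvg_fst _ _ (0 : R)^'+ (nbhs u) _ _ (nbhs_right_gt 0)).
Qed.

Lemma cvg_fst_right0 (R : realType) (n : nat) (u : 'rV[R]_n) :
  p.1 @[p --> filter_prod (0 : R)^'+ (nbhs u)] --> (0 : R).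
Proof. by apply: cvg_trans cvg_fst _; exact: cvg_within. Qed.

(** The pairs at which the difference quotient is visibly nonnegative form a
    member [V] of the filter, and the lower limit is a supremum of infima over
    such members. *)
Lemma subderivative_ge0 (R : realType) (n : nat) (phi : 'rV[R]_n -> \bar R)
    (xbar u : 'rV[R]_n) : phi xbar \is a fin_num ->
  (\forall p \near filter_prod (0 : R)^'+ (nbhs u),
     (phi xbar <= phi (xbar + p.1 *: p.2)%R)%E) ->
  (0 <= subderivative phi xbar u)%E.
Proof.
move=> phi_fin Hmin; rewrite /subderivative limf_einfE.
pose V := [set p : R * 'rV[R]_n |
  0 < p.1 /\ (phi xbar <= phi (xbar + p.1 *: p.2)%R)%E].
have HV : filter_prod (0 : R)^'+ (nbhs u) V.
  exact: filterI (near_fst_gt0 _ _ u) Hmin.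
apply: le_trans (ereal_sup_ubound (ex_intro2 _ _ V HV erefl)).
apply: le_ereal_inf_tmp => _ [[t v] [/= t0 Hphi] <-].
apply: mule_ge0; first by rewrite sube_ge0// phi_fin.
by rewrite inve_ge0 lee_fin ltW.
Qed.

(** For a unit [u], the cone inequality at [t *: v] is [t] times the one at
    [v], and at [v = u] it reads [0 <= rho]; the positivity of [rho] leaves a
    gap, which continuity preserves for [v] near [u]. *)
Lemma dir_nbhd_scale_near (R : realType) (n : nat) (eps rho : R)
    (u : 'rV[R]_n) : 0 < eps -> 0 < rho -> enorm u = 1 ->
  \forall p \near filter_prod (0 : R)^'+ (nbhs u),
    dir_nbhd eps rho u (p.1 *: p.2).
Proof.
move=> eps0 rho0 u1.
have cvg2 : (fun p : R * 'rV[R]_n => p.2) @ filter_prod (0 : R)^'+ (nbhs u)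
    --> u by exact: cvg_snd.
have cvg1 := @cvg_fst_right0 R n u.
have cvgn : enorm p.2 @[p --> filter_prod (0 : R)^'+ (nbhs u)] --> (1 : R).
  by rewrite -u1; exact: (cvg_comp _ _ cvg2 (@enorm_continuous R n u)).
have small : \forall p \near filter_prod (0 : R)^'+ (nbhs u),
    p.1 * enorm p.2 < eps.
  have H : p.1 * enorm p.2 @[p --> filter_prod (0 : R)^'+ (nbhs u)]
      --> (0 * 1 : R) by exact: cvgM.
  by apply: (cvgr_lt _ H); rewrite mul0r.
have cone : \forall p \near filter_prod (0 : R)^'+ (nbhs u),
    enorm (enorm p.2 *: u - p.2) - rho * enorm p.2 < 0.
  have H : enorm (enorm p.2 *: u - p.2) - rho * enorm p.2
      @[p --> filter_prod (0 : R)^'+ (nbhs u)]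
      --> enorm (1 *: u - u) - rho * 1.
    apply: cvgB; last by apply: cvgM => //; exact: cvg_cst.
    have D : enorm p.2 *: u - p.2 @[p --> filter_prod (0 : R)^'+ (nbhs u)]
        --> 1 *: u - u.
      by apply: cvgB => //; apply: cvgZ => //; exact: cvg_cst.
    exact: (cvg_comp _ _ D (@enorm_continuous R n _)).
  apply: (cvgr_lt _ H).
  by rewrite scale1r subrr enorm0 sub0r mulr1 oppr_lt0.
have pos := near_fst_gt0 _ _ u.
near=> p; have t0 : 0 < p.1 by near: p.
have enorm_p : enorm (p.1 *: p.2) = p.1 * enorm p.2 by rewrite enormZ gtr0_norm.
split; rewrite enorm_p.
  by apply: ltW; near: p.
rewrite u1 scale1r mulr1 -scalerA -scalerBr enormZ gtr0_norm// mulrCA.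
rewrite ler_pM2l// ltW// -subr_lt0; by near: p.
Unshelve. all: by end_near. Qed.

Theorem proposition3p3 (R : realType) (n : nat) (phi : 'rV[R]_n -> \bar R)
    (xbar : 'rV[R]_n) (phi_lsc : lower_semicontinuous phi)
    (phi_xbar_fin : phi xbar \is a fin_num) :
  (forall u : 'rV[R]_n, unit_sphere u -> dir_local_minimizer phi xbar u ->
     (0 <= subderivative phi xbar u)%E) /\
  (local_minimizer phi xbar ->
     forall u : 'rV[R]_n, unit_sphere u -> (0 <= subderivative phi xbar u)%E).
Proof.
split=> [u u1 [eps [rho [eps0 rho0 Hmin]]]|Hmin u _];
  apply: subderivative_ge0 => //.
  by apply: filterS (dir_nbhd_scale_near _ _ _ _ _ eps0 rho0 u1) => p /Hmin.
suff to_xbar : xbar + p.1 *: p.2 @[p --> filter_prod (0 : R)^'+ (nbhs u)] --> xbar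
  by exact: to_xbar Hmin.
rewrite -[X in _ --> X]addr0 -(scale0r u).
apply: cvgD; first exact: cvg_cst.
by apply: cvgZ; [exact: cvg_fst_right0 | exact: cvg_snd].
Qed.
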